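(* In the setting described in the context, the value function $v:X\to\mathbb{R}$, $$v(x)=\inf_{y\in Y}\{f(x,y)\ \text{s.t.}\ g(x,y)\le0\},$$ is convex and Lipschitz continuous around any point in the set $X$. Given $\bar x\in X$ and $\bar y\in S(\bar x)$, we have $$\partial v(\bar x)=\{\xi\in\mathbb{R}^n:(\xi,0)\in\partial\phi(\bar x,\bar y)\},$$ where $\phi(x,y):=f(x,y)+\delta_D(x,y)$ and $D:=\{(x,y)\in\mathcal O\times Y\mid g(x,y)\le0\}$.
   Context: Setting. $X\subseteq\mathbb{R}^n$ and $Y\subseteq\mathbb{R}^m$ are nonempty closed convex sets; $g=(g_1,\dots,g_l)$, where each $g_i:\mathbb{R}^n\times\mathbb{R}^m\to\mathbb{R}$ is convex (jointly in $(x,y)$) on an open convex set containing $X\times Y$; $f:\mathbb{R}^n\times\mathbb{R}^m\to\mathbb{R}$ is convex (jointly in $(x,y)$) on an open convex set containing $C:=\{(x,y)\in X\times Y: g(x,y)\le0\}$. $S(x)$ is the set of optimal solutions of the lower level problem $\min_{y\in Y} f(x,y)$ s.t. $g(x,y)\le0$, and $S(x)\ne\emptyset$ for all $x\in X$. $\mathcal O\supseteq X$ is an open convex set such that for all $x\in\mathcal O$ the feasible region $\mathcal F(x):=\{y\in Y:g(x,y)\le0\}$ is nonempty and $f(x,\cdot)$ is bounded below on $\mathcal F(x)$. $\delta_D$ is the indicator function of $D$ ($0$ on $D$, $+\infty$ off $D$). $\partial$ is the subdifferential of convex analysis: $\partial\varphi(\bar x)=\{\xi:\varphi(x)\ge\varphi(\bar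 x)+\langle\xi,x-\bar x\rangle\ \forall x\}$. For the purpose of $\partial v$, $v$ is extended to all of $\mathbb{R}^n$ by $v(x):=\inf_{y\in\mathbb{R}^m}\phi(x,y)$ (so $v(x)=+\infty$ for $x\notin\mathcal O$).
   Formalization: Lipschitz continuity is claimed only when the open convex sets on which the g_i and f are convex can be chosen to contain O×Y and D, not just X×Y and C; without this it can fail (e.g. v(x) = -√x on [0,1]). Convexity and the formula for ∂v need no such assumption. *)

(* Defs.v *)
From HB Require Import structures.
From mathcomp Require Import all_boot all_order all_algebra.
From mathcomp Require Import all_classical all_reals all_analysis.
Set Implicit Arguments.
Unset Strict Implicit.
Unset Printing Implicit Defensive.
Import Order.TTheory GRing.Theory Num.Theory.
Import numFieldNormedType.Exports.
Local Open Scope classical_set_scope.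
Local Open Scope ring_scope.

Section convex_analysis.
Context {R : realType}.

Definition dot {n} (u v : 'rV[R]_n) : R := (u *m v^T) 0 0.

Definition dot2 {n m} (p q : 'rV[R]_n * 'rV[R]_m) : R :=
  dot p.1 q.1 + dot p.2 q.2.

Definition indicator {T : Type} (D : set T) (x : T) : \bar R :=
  if x \in D then 0%E else +oo%E.

(* [ip] is the inner product of the ambient Euclidean space [E]. *)
Definition subdifferential {E : lmodType R} (ip : E -> E -> R)
    (phi : E -> \bar R) (xbar : E) : set E :=
  [set xi | forall x, (phi xbar + (ip xi (x - xbar))%:E <= phi x)%E].

Definition convex_around {n m} (A : set ('rV[R]_n * 'rV[R]_m))
    (h : 'rV[R]_n * 'rV[R]_m -> R) : Prop :=
  exists U : set ('rV[R]_n * 'rV[R]_m),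
    [/\ open U, convex_set U, A `<=` U & convex_function U h].

End convex_analysis.

Section bilevel.
Context {R : realType} {n m l : nat}.
Implicit Types (X O : set 'rV[R]_n) (Y : set 'rV[R]_m).
Implicit Types (g : 'I_l -> 'rV[R]_n * 'rV[R]_m -> R).
Implicit Types (f : 'rV[R]_n * 'rV[R]_m -> R).

Definition constraint_set X Y g : set ('rV[R]_n * 'rV[R]_m) :=
  [set p | [/\ X p.1, Y p.2 & forall i, g i p <= 0]].

Definition feasible Y g (x : 'rV[R]_n) : set 'rV[R]_m :=
  [set y | Y y /\ forall i, g i (x, y) <= 0].

Definition solution_set Y g f (x : 'rV[R]_n) : set 'rV[R]_m :=
  [set y | feasible Y g x y /\
    forall y', feasible Y g x y' -> f (x, y) <= f (x, y')].

Definition value_function Y g f (x : 'rV[R]_n) : R :=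
  inf [set f (x, y) | y in feasible Y g x].

Definition phi O Y g f (p : 'rV[R]_n * 'rV[R]_m) : \bar R :=
  ((f p)%:E + indicator (constraint_set O Y g) p)%E.

Definition value_extension O Y g f (x : 'rV[R]_n) : \bar R :=
  ereal_inf [set phi O Y g f (x, y) | y in [set: 'rV[R]_m]].

Record bilevel_setting X Y g f O : Prop := BilevelSetting {
  X_nonempty : X !=set0;
  X_closed : closed X;
  X_convex : convex_set X;
  Y_nonempty : Y !=set0;
  Y_closed : closed Y;
  Y_convex : convex_set Y;
  g_convex : forall i, convex_around (X `*` Y) (g i);
  f_convex : convex_around (constraint_set X Y g) f;
  solvable_on_X : forall x, X x -> solution_set Y g f x !=set0;
  O_open : open O;
  O_convex : convex_set O;
  X_sub_O : X `<=` O;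
  feasible_on_O : forall x, O x -> feasible Y g x !=set0;
  bounded_on_O : forall x, O x -> has_lbound [set f (x, y) | y in feasible Y g x]
}.

(* The functions are total, and [bilevel_setting] says nothing about their
   convexity over [O `\` X].  This is what makes [phi] convex; without it
   [value_function] may fail to be Lipschitz even relative to [X]:
   X = [0, 1], Y = {y1 > 0, y1 y2 >= 1, |y3| <= 1}, f = y3, O = R, and
   g = y3^2 - x on the half-space x + y2 > 0, g = -1 elsewhere, give
   v(x) = - sqrt x on X. *)
Definition convex_data_over O Y g f : Prop :=
  (forall i, convex_around (O `*` Y) (g i)) /\
  convex_around (constraint_set O Y g) f.

End bilevel.

(* Main.v *)
Require Import Defs.
From HB Require Import structures.
From mathcomp Require Import all_boot all_order all_algebra.
From mathcomp Require Import all_classical all_reals all_analysis.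
From mathcomp Require Import ring lra.
Import Order.TTheory GRing.Theory Num.Theory.
Import numFieldNormedType.Exports.
Local Open Scope classical_set_scope.
Local Open Scope ring_scope.

(** The value function is the marginal of a jointly convex function, and each
    claim comes from moving between points of the graph and their projections.

    Convexity: combining near-minimisers at two parameters gives, by joint
    convexity of the constraints, a feasible point at the combined parameter,
    and joint convexity of the objective bounds its value
    ([value_function_convex]). The argument works over any convex set of
    parameters on which the data are convex and the infimum is finite, so it
    applies both to [X] and to the open set [O].

    Lipschitz continuity: [X] may have empty interior, so it is the convexity
    over [O] that matters. A finite convex function near an interior point is
    bounded above ([convex_bounded_above_near]; here finite dimension is used),
    and a convex function bounded above on a ball is bounded below on it by
    reflection through the centre, hence Lipschitz on a smaller ball, since a
    chord can be prolonged by a fixed length ([convex_lipschitz_near]).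

    Subdifferential: at a minimiser the value function and [phi] agree, and an
    affine function of [x] alone lies below [phi] exactly when it lies below the
    infimum of [phi] over [y] ([subdifferential_value_extension]). *)

(** * Convex combinations *)

Lemma convex_comb_translate {R : pzRingType} {E : lmodType R} (t : R) (x a b : E) :
  t *: (x + a) + (1 - t) *: (x + b) = x + (t *: a + (1 - t) *: b).
Proof. by rewrite !scalerDr addrACA -scalerDl subrKC scale1r. Qed.

(** Convexity with an unbundled weight [t], so that weights can be computed with;
    likewise for functions in the next lemma. *)
Lemma convex_setP {R : realType} {E : lmodType R} {A : set E} {t : R} {x y : E} :
  convex_set A -> 0 <= t <= 1 -> A x -> A y -> A (t *: x + (1 - t) *: y).
Proof.
move=> cA /andP[t0 t1] Ax Ay.
by have /set_mem := cA x y (Itv01 t0 t1) (mem_set Ax) (mem_set Ay).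
Qed.

Lemma convex_functionP {R : realType} {E : lmodType R} {A : set E} {h : E -> R} :
  convex_function A h <->
  forall (t : R) (x y : E), 0 <= t <= 1 -> A x -> A y ->
    h (t *: x + (1 - t) *: y) <= t * h x + (1 - t) * h y.
Proof.
split=> [ch t x y /andP[t0 t1] Ax Ay|ch t x y /set_mem Ax /set_mem Ay].
  exact: (ch (Itv01 t0 t1) x y (mem_set Ax) (mem_set Ay)).
by apply: ch => //; apply/andP; split.
Qed.

Lemma convex_around_on {R : realType} {n m : nat}
    {A : set ('rV[R]_n * 'rV[R]_m)} {h : 'rV[R]_n * 'rV[R]_m -> R} :
  convex_around A h -> convex_function A h.
Proof.
case=> U [_ _ AU /convex_functionP cU]; apply/convex_functionP => t x y t01 Ax Ay.
by apply: cU => //; apply: AU.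
Qed.

(** * The value function *)

(** The infimum need not be attained on [P], hence the minimisers up to [e]:
    combining them loses only [e], which is arbitrary. *)
Lemma value_function_convex {R : realType} {n m l : nat}
    (P : set 'rV[R]_n) (Y : set 'rV[R]_m)
    (g : 'I_l -> 'rV[R]_n * 'rV[R]_m -> R) (f : 'rV[R]_n * 'rV[R]_m -> R) :
  convex_set P -> convex_set Y ->
  (forall i, convex_function (P `*` Y) (g i)) ->
  convex_function (constraint_set P Y g) f ->
  (forall x, P x -> feasible Y g x !=set0) ->
  (forall x, P x -> has_lbound [set f (x, y) | y in feasible Y g x]) ->
  convex_function P (value_function Y g f).
Proof.
move=> cP cY cg /convex_functionP cf ne lb; apply/convex_functionP => t x1 x2 t01 P1 P2.
apply/ler_addgt0Pr => e e0.
have near_min x : P x ->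
    exists2 y, feasible Y g x y & f (x, y) < value_function Y g f x + e.
  move=> Px; have hi : has_inf [set f (x, y) | y in feasible Y g x].
    by split; [case: (ne x Px) => y Fy; exists (f (x, y)), y | exact: lb].
  by have [_ [y Fy <-] lty] := inf_adherent e0 hi; exists y.
have [y1 [Y1 G1] l1] := near_min _ P1.
have [y2 [Y2 G2] l2] := near_min _ P2.
have Pt := convex_setP cP t01 P1 P2.
set xt := t *: x1 + (1 - t) *: x2 in Pt *.
have /andP[t0 t1] := t01.
have Ft : feasible Y g xt (t *: y1 + (1 - t) *: y2).
  split; first exact: convex_setP.
  move=> i; have /convex_functionP cgi := cg i.
  apply: (le_trans (cgi t (x1, y1) (x2, y2) t01 _ _)) => //.
  have := G1 i; have := G2 i; nra.
apply: (@le_trans _ _ (f (xt, t *: y1 + (1 - t) *: y2))).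
  by apply: ge_inf; [exact: lb | exists (t *: y1 + (1 - t) *: y2)].
apply: (le_trans (cf t (x1, y1) (x2, y2) t01 _ _)) => //; nra.
Qed.

(** Infeasible [y] contribute only [+oo] to the infimum. *)
Lemma value_extensionE {R : realType} {n m l : nat}
    (O : set 'rV[R]_n) (Y : set 'rV[R]_m)
    (g : 'I_l -> 'rV[R]_n * 'rV[R]_m -> R) (f : 'rV[R]_n * 'rV[R]_m -> R) x :
  O x -> feasible Y g x !=set0 ->
  has_lbound [set f (x, y) | y in feasible Y g x] ->
  value_extension O Y g f x = (value_function Y g f x)%:E.
Proof.
move=> Ox [y0 F0] lb; rewrite /value_extension /value_function.
have phiF y : feasible Y g x y -> phi O Y g f (x, y) = (f (x, y))%:E.
  by move=> [Yy Gy]; rewrite /phi /indicator mem_set ?adde0.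
apply/eqP; rewrite eq_le; apply/andP; split.
  rewrite -ereal_inf_EFin //; last by exists (f (x, y0)), y0.
  by apply: ereal_inf_le_tmp => _ [_ [y Fy <-] <-]; exists y => //; exact: phiF.
apply: le_ereal_inf_tmp => _ [y _ <-].
have [Fy|nFy] := pselect (feasible Y g x y).
  by rewrite phiF // lee_fin; apply: ge_inf => //; exists y.
rewrite /phi /indicator memNset ?addey ?leey // => -[] /= _ Yy Gy.
by apply: nFy.
Qed.

(** * Local Lipschitz continuity of convex functions *)

(** The norm of a row vector is the sup norm. The sign condition on [c] covers
    dimension 0, where the right-hand side is empty. *)
Lemma ler_row_norm {R : realType} {n : nat} (u : 'rV[R]_n) (c : R) : 0 <= c ->
  (`|u| <= c) = [forall i, `|u ord0 i| <= c].
Proof.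
move=> c0; rewrite [leLHS]mx_normrE; apply/idP/forallP => [uc i|uc].
  apply: le_trans uc.
  exact: (le_bigmax _ (fun ij : 'I_1 * 'I_n => `|u ij.1 ij.2|) (ord0, i)).
by apply: bigmax_le => // -[i j] _ /=; rewrite (ord1 i).
Qed.

(** Induction on the number [k] of coordinates in which the displacement may be
    nonzero. A displacement [w + c *: e] with one more coordinate is the midpoint
    of [2 *: w] and [(2 * c) *: e]: the first is covered by the induction
    hypothesis and the second lies on a segment, where a convex function is
    bounded by its values at the two ends. Each step halves the radius. *)
Lemma convex_bounded_above_near {R : realType} {n : nat}
    {O : set 'rV[R]_n} {h : 'rV[R]_n -> R} {x : 'rV[R]_n} {r : R} :
  convex_function O h -> 0 < r -> (forall u, `|u| <= r -> O (x + u)) ->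
  exists M, exists2 s, 0 < s <= r & forall u, `|u| <= s -> h (x + u) <= M.
Proof.
move=> /convex_functionP ch r0 Or.
suff : forall k, (k <= n)%N -> exists M, exists2 s, 0 < s <= r &
    forall u : 'rV[R]_n, `|u| <= s -> (forall i : 'I_n, (k <= i)%N -> u ord0 i = 0) ->
    h (x + u) <= M.
  case/(_ n (leqnn n)) => M [s s0 hM]; exists M, s => // u us.
  by apply: hM => // i; rewrite leqNgt ltn_ord.
elim=> [_|k IH ltkn].
  exists (h x), r; rewrite ?r0 ?lexx // => u _ u0.
  suff -> : u = 0 by rewrite addr0.
  by apply/rowP => i; rewrite u0 // mxE.
have [M [s /andP[s0 sr] hM]] := IH (ltnW ltkn).
pose e : 'rV[R]_n := delta_mx ord0 (Ordinal ltkn).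
have ne c : `|c *: e| <= `|c|.
  rewrite ler_row_norm //; apply/forallP => i.
  by rewrite !mxE eqxx /=; case: (i == _); rewrite ?mulr1 // mulr0 normr0.
(* [N] bounds [h] on the segment through [x] in the new direction [e]. *)
pose N := Num.max (h (x + s *: e)) (h (x + (- s) *: e)).
have hN c : `|c| <= s -> h (x + c *: e) <= N.
  move=> cs; pose t := (c / s + 1) / 2.
  have ct : c = t * s + (1 - t) * (- s).
    by rewrite /t; field; exact: lt0r_neq0.
  have t01 : 0 <= t <= 1.
    have : `|c / s| <= 1 by rewrite normf_div (gtr0_norm s0) ler_pdivrMr // mul1r.
    by rewrite ler_norml /t => /andP[c1 c2]; apply/andP; split; lra.
  have -> : x + c *: e = t *: (x + s *: e) + (1 - t) *: (x + (- s) *: e).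
    by rewrite convex_comb_translate !scalerA -scalerDl -ct.
  have sO d : `|d| = s -> O (x + d *: e).
    by move=> ds; apply: Or; rewrite (le_trans (ne _)) // ds.
  apply: (le_trans (ch t _ _ t01 _ _)).
  - by apply: sO; rewrite gtr0_norm.
  - by apply: sO; rewrite normrN gtr0_norm.
  have /andP[t0 t1] := t01.
  have a : h (x + s *: e) <= N by rewrite /N le_max lexx.
  have b : h (x + (- s) *: e) <= N by rewrite /N le_max lexx orbT.
  nra.
exists (2^-1 * M + (1 - 2^-1) * N), (s / 2).
  by apply/andP; split; lra.
move=> u us u0.
pose c := u ord0 (Ordinal ltkn).
pose w := u - c *: e.
have uc i : `|u ord0 i| <= s / 2.
  by move: us; rewrite ler_row_norm ?divr_ge0 ?(ltW s0) // => /forallP.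
have wE i : w ord0 i = if (i < k)%N then u ord0 i else 0.
  rewrite !mxE eqxx /=; case: (ltngtP i k) => ik.
  - by rewrite (_ : i == _ = false) ?mulr0 ?subr0 //; apply/eqP => ii; rewrite ii ltnn in ik.
  - by rewrite u0 // (_ : i == _ = false) ?mulr0 ?subr0 //; apply/eqP => ii; rewrite ii ltnn in ik.
  - have -> : i = Ordinal ltkn by exact/val_inj.
    by rewrite eqxx mulr1 subrr.
have -> : x + u = 2^-1 *: (x + 2 *: w) + (1 - 2^-1) *: (x + (2 * c) *: e).
  rewrite convex_comb_translate !scalerA.
  rewrite mulVf ?pnatr_eq0 // scale1r.
  have -> : (1 - 2^-1) * (2 * c) = c :> R by field.
  by rewrite /w subrK.
have w2 : `|2 *: w| <= s.
  rewrite ler_row_norm ?ltW //; apply/forallP => j.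
  rewrite mxE wE; case: ifP => _; last by rewrite mulr0 normr0 ltW.
  by rewrite normrM gtr0_norm //; have := uc j; lra.
have c2 : `|2 * c| <= s by rewrite normrM gtr0_norm //; have := uc (Ordinal ltkn); rewrite -/c; lra.
apply: (le_trans (ch _ _ _ _ _ _)).
- by apply/andP; split; lra.
- by apply: Or; exact: le_trans sr.
- by apply: Or; apply: (le_trans (ne _)); exact: le_trans sr.
have : h (x + 2 *: w) <= M by apply: hM => // i ki; rewrite mxE wE ltnNge ki mulr0.
by have := hN _ c2; lra.
Qed.

(** For [a] and [b] in the half-size ball, prolonging the segment from [a] to [b]
    by [s / 2] reaches a point [z] of the ball of radius [s]. The slope of a
    convex function increases along the line, so the slope from [a] to [b] is at
    most [K / (s / 2)], where [K] bounds the oscillation of [h] on the ball. *)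
Lemma convex_lipschitz_near {R : realType} {V : normedModType R}
    {O : set V} {h : V -> R} {x : V} {M s : R} :
  convex_function O h -> 0 < s -> (forall u, `|u| <= s -> O (x + u)) ->
  (forall u, `|u| <= s -> h (x + u) <= M) ->
  lipschitz_on (h : V -> R^o) (nbhs (x, x)).
Proof.
move=> /convex_functionP ch s0 Os hM.
(* [x] is the midpoint of [x + u] and [x - u], where [h] is at most [M]. *)
have lo u : `|u| <= s -> 2 * h x - M <= h (x + u).
  move=> us; have us' : `|- u| <= s by rewrite normrN.
  have := ch 2^-1 _ _ _ (Os _ us) (Os _ us').
  have -> : 2^-1 *: (x + u) + (1 - 2^-1) *: (x + - u) = x.
    rewrite convex_comb_translate; have -> : 1 - 2^-1 = 2^-1 :> R by field.
    by rewrite -scalerDr subrr scaler0 addr0.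
  have h2 : 0 <= (2^-1 : R) <= 1 by apply/andP; split; lra.
  by move/(_ h2); have := hM _ us'; lra.
pose K := 2 * (M - h x).
have osc u w : `|u| <= s -> `|w| <= s -> h (x + u) - h (x + w) <= K.
  by move=> us ws; have := hM _ us; have := lo _ ws; rewrite /K; lra.
have K0 : 0 <= K.
  by have := osc 0 0; rewrite !normr0 subrr => -> //; exact: ltW.
have half a b : `|a - x| < s / 2 -> `|b - x| < s / 2 ->
    h b - h a <= 2 * K / s * `|b - a|.
  move=> ax bx; have [->|nba] := eqVneq b a; first by rewrite !subrr normr0 mulr0.
  pose d := `|b - a|; have d0 : 0 < d by rewrite normr_gt0 subr_eq0.
  pose z := b + (s / 2 / d) *: (b - a).
  (* The position of [b] on the segment from [a] (weight 0) to [z] (weight 1). *)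
  pose t := d / (d + s / 2).
  have D0 : 0 < d + s / 2 by rewrite addr_gt0 // divr_gt0.
  have t01 : 0 <= t <= 1.
    by apply/andP; split; rewrite /t ?divr_ge0 ?ler_pdivrMr //; lra.
  have bE : b = t *: z + (1 - t) *: a.
    rewrite /z; set q := s / 2 / d.
    have tq : t * (1 + q) = 1.
      by rewrite /t /q; field; rewrite !lt0r_neq0 //; lra.
    have -> : b + q *: (b - a) = a + (1 + q) *: (b - a).
      by rewrite scalerDl scale1r addrA subrKC.
    by rewrite -{3}[a]addr0 convex_comb_translate scaler0 addr0 scalerA tq scale1r subrKC.
  have az : `|z - x| <= s.
    rewrite /z addrAC; apply: (le_trans (ler_normD _ _)).
    rewrite normrZ -/d ger0_norm; last by rewrite !divr_ge0 // ltW.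
    by rewrite divfK ?lt0r_neq0 //; lra.
  have ax' : `|a - x| <= s by lra.
  have Oz : O z by rewrite -(subrKC x z); exact: Os.
  have Oa : O a by rewrite -(subrKC x a); exact: Os.
  have := ch t z a t01 Oz Oa; rewrite -bE => hb.
  have := osc _ _ az ax'; rewrite !subrKC => zaK.
  have /andP[t0 t1] := t01.
  have tK : t * K <= 2 * K / s * d.
    have : t <= 2 / s * d.
      rewrite /t ler_pdivrMr //.
      have -> : 2 / s * d * (d + s / 2) = d + 2 / s * d * d by field; exact: lt0r_neq0.
      by rewrite lerDl !mulr_ge0 ?invr_ge0 // ltW.
    have -> : 2 * K / s * d = 2 / s * d * K by field; exact: lt0r_neq0.
    exact: ler_wpM2r.
  rewrite -/d; have : t * (h z - h a) <= t * K by exact: ler_wpM2l.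
  by move: hb tK; lra.
apply: (@klipschitzW _ _ _ (2 * K / s)).
have s20 : 0 < s / 2 by rewrite divr_gt0.
exists (ball x (s / 2), ball x (s / 2)); first by split; exact: nbhsx_ballx.
move=> [a b] /= [].
rewrite -!ball_normE /ball_ /= ![`|x - _|]distrC => ax bx.
rewrite ler_norml; apply/andP; split; last exact: half.
by rewrite lerNl opprB distrC; exact: half.
Qed.

(** * Subgradients of the value function *)

(** A vector [(xi, 0)] pairs only with the [x]-displacement, so the subgradient
    inequality for [phi] bounds every [phi (x', y')] below by a quantity free of
    [y']; this is the same as bounding their infimum over [y']. *)
Lemma subdifferential_value_extension {R : realType} {n m l : nat}
    (O : set 'rV[R]_n) (Y : set 'rV[R]_m)
    (g : 'I_l -> 'rV[R]_n * 'rV[R]_m -> R) (f : 'rV[R]_n * 'rV[R]_m -> R) x y :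
  value_extension O Y g f x = phi O Y g f (x, y) ->
  subdifferential dot (value_extension O Y g f) x =
  [set xi | subdifferential dot2 (phi O Y g f) (x, y) (xi, 0)].
Proof.
move=> vE.
have dotE xi (p : 'rV[R]_n * 'rV[R]_m) : dot2 (xi, 0) (p - (x, y)) = dot xi (p.1 - x).
  by rewrite /dot2 /dot /= mul0mx [X in _ + X]mxE addr0.
apply/seteqP; split=> xi H.
  move=> [x' y']; rewrite dotE -vE; apply: (le_trans (H x')).
  by apply: ereal_inf_lbound; exists y'.
move=> x'; apply: le_ereal_inf_tmp => _ [y' _ <-].
by rewrite vE; have := H (x', y'); rewrite dotE.
Qed.

(** * Convexity, Lipschitz continuity and subdifferential *)

Theorem lemma3 (R : realType) (n m l : nat)
    (X : set 'rV[R]_n) (Y : set 'rV[R]_m)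
    (g : 'I_l -> 'rV[R]_n * 'rV[R]_m -> R)
    (f : 'rV[R]_n * 'rV[R]_m -> R)
    (O : set 'rV[R]_n)
    (setting : bilevel_setting X Y g f O) :
  [/\ (forall x, X x ->
         value_extension O Y g f x = (value_function Y g f x)%:E),
      convex_function X (value_function Y g f),
      (convex_data_over O Y g f ->
         forall x, X x ->
           lipschitz_on (value_function Y g f : 'rV[R]_n -> R^o) (nbhs (x, x)))
    & forall (xbar : 'rV[R]_n) (ybar : 'rV[R]_m),
        X xbar -> solution_set Y g f xbar ybar ->
        subdifferential dot (value_extension O Y g f) xbar =
        [set xi | subdifferential dot2 (phi O Y g f) (xbar, ybar) (xi, 0)]].
Proof.
case: setting => _ _ cX _ _ cY cg cf _ oO cO XO ne lb.
have vE x : X x -> value_extension O Y g f x = (value_function Y g f x)%:E.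
  by move=> /XO Ox; apply: value_extensionE => //; [exact: ne|exact: lb].
split=> //.
- apply: value_function_convex => //.
  + by move=> i; exact/convex_around_on.
  + exact/convex_around_on.
  + by move=> x /XO /ne.
  + by move=> x /XO /lb.
- move=> [cgO cfO] x /XO Ox.
  have cv : convex_function O (value_function Y g f).
    apply: value_function_convex => //.
    + by move=> i; exact/convex_around_on.
    + exact/convex_around_on.
  have /nbhs_ballP[r /= r0 rO] : nbhs x O by exact: open_nbhs_nbhs.
  have Or u : `|u| <= r / 2 -> O (x + u).
    move=> ur; apply: rO; rewrite -ball_normE /ball_ /= opprD addrA subrr sub0r normrN.
    by lra.
  have r20 : 0 < r / 2 by rewrite divr_gt0.
  have [M [s /andP[s0 sr] hM]] := convex_bounded_above_near cv r20 Or.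
  apply: (convex_lipschitz_near cv s0 _ hM) => u us.
  by apply: Or; exact: le_trans sr.
- move=> x y Xx [[Yy Gy] ymin].
  apply: subdifferential_value_extension; rewrite vE //.
  have Ox := XO _ Xx.
  rewrite /phi /indicator mem_set ?adde0 //; congr EFin.
  apply/eqP; rewrite eq_le; apply/andP; split.
    by apply: ge_inf; [exact: lb | exists y].
  apply: lb_le_inf; first by exists (f (x, y)), y.
  by move=> _ [y' Fy' <-]; exact: ymin.
Qed.
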